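(* Let $a>b>0$, let $\mathcal{E}:\ \frac{\mathsf{x}^2}{a}+\frac{\mathsf{y}^2}{b}=1$, and let $\mathcal{C}_{\lambda_0}$, $\lambda_0\in(0,b)\cup(b,a)$, be a conic confocal with $\mathcal{E}$. Suppose that the billiard trajectories within $\mathcal{E}$ with caustic $\mathcal{C}_{\lambda_0}$ are $n$-periodic with winding numbers $(m_0,m_1)$, $m_0=n$. Let $c_1>c_2>c_3>c_4=0$ be the elements of $\{0,1/a,1/b,1/\lambda_0\}$ in decreasing order, and let $\hat p_n$, $\hat q_{n-2}$ be real polynomials of degrees $n$, $n-2$ with $\hat p_n^2(s)-\prod_{i=1}^4(s-c_i)\,\hat q_{n-2}^2(s)=1$. Let $\tau_1$ be the number of zeros of $\hat q_{n-2}$ in the interval $(c_2,c_1)$. Then $$m_0=m_1+\tau_1+1,$$ and in particular $$m_0>m_1.$$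
   Context: The confocal family is $\mathcal{C}_{\lambda}:\ \frac{\mathsf{x}^2}{a-\lambda}+\frac{\mathsf{y}^2}{b-\lambda}=1$; $\mathcal{C}_\lambda$ is an ellipse for $\lambda<b$ and a hyperbola for $\lambda\in(b,a)$. Billiard trajectories within $\mathcal{E}$ are polygonal lines with vertices on $\mathcal{E}$ obeying the reflection law at each vertex; a trajectory has caustic $\mathcal{C}_{\lambda_0}$ if all lines containing its segments are tangent to $\mathcal{C}_{\lambda_0}$. A trajectory is $n$-periodic if it closes after $n$ reflections. The winding numbers $(m_0,m_1)$ of a periodic billiard trajectory are: $m_0$ is the number of its reflection points, and $m_1$ the number of its intersections with the $\mathsf{y}$-axis, both counted along the period. (Polynomials $\hat p_n,\hat q_{n-2}$ as in the claim exist whenever the trajectories are $n$-periodic.) *)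

(* Defs.v *)
From HB Require Import structures.
From mathcomp Require Import all_boot all_order all_algebra.
From mathcomp Require Import all_classical reals.

Set Implicit Arguments.
Unset Strict Implicit.
Unset Printing Implicit Defensive.

Import Order.TTheory GRing.Theory Num.Theory.

Local Open Scope card_scope.
Local Open Scope classical_set_scope.
Local Open Scope ring_scope.

Section Billiard.
Variable R : realType.

Definition conic (A B : R) : set (R * R) :=
  [set v | v.1 ^+ 2 / A + v.2 ^+ 2 / B = 1].

(* For P <> Q: [X : Y : Z] is a point of the projective closure of the conic
   x^2 / A + y^2 / B = 1, and P, Q lie on the tangent (polar) line at that
   point.  For Z = 0 this is an asymptote, i.e. the line touches a hyperbola at
   infinity; a segment lying on an asymptote does occur in trajectories whose
   caustic is a hyperbola. *)
Definition tangent_line (A B : R) (P Q : R * R) : Prop :=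
  exists X Y Z : R,
    [/\ (X, Y, Z) <> (0, 0, 0),
        X ^+ 2 / A + Y ^+ 2 / B = Z ^+ 2,
        P.1 * X / A + P.2 * Y / B = Z
      & Q.1 * X / A + Q.2 * Y / B = Z].

Definition dot (u v : R * R) : R := u.1 * v.1 + u.2 * v.2.

(* R itself has no left-module structure over R (only R^o has), hence the
   explicit scaling of R * R. *)
Definition scale (k : R) (v : R * R) : R * R := (k * v.1, k * v.2).

(* Mirror image of the direction u in the line orthogonal to N. *)
Definition mirror (N u : R * R) : R * R :=
  u - scale (2 * dot u N / dot N N) N.

(* Half the gradient of x^2 / a + y^2 / b at v. *)
Definition ellipse_normal (a b : R) (v : R * R) : R * R := (v.1 / a, v.2 / b).

(* P 0, P 1, ... are the consecutive vertices; the segments are automatically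
   inside the ellipse, which is convex.  The reflection law at P i.+1 says that
   the outgoing direction is that of the mirror image of the incoming one. *)
Definition billiard_trajectory (a b : R) (P : nat -> R * R) : Prop :=
  [/\ forall i, conic a b (P i),
      forall i, P i <> P i.+1
    & forall i, exists2 k : R, 0 < k &
        P i.+2 - P i.+1 =
          scale k (mirror (ellipse_normal a b (P i.+1)) (P i.+1 - P i))].

Definition has_caustic (a b l : R) (P : nat -> R * R) : Prop :=
  forall i, tangent_line (a - l) (b - l) (P i) (P i.+1).

(* n is a period, not necessarily the least one.  Together with the reflection
   law at P n, this gives the reflection law at P 0. *)
Definition n_periodic (n : nat) (P : nat -> R * R) : Prop :=
  (0 < n)%N /\ forall i, P (i + n)%N = P i.

(* The passages through the y-axis along one period: the pair (i, u) stands for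
   the point at parameter u of the segment from P i to P i.+1.  The parameter
   ranges over [0, 1), so that a vertex on the y-axis is counted once, while a
   point visited several times is counted at each visit. *)
Definition y_axis_passages (n : nat) (P : nat -> R * R) : set (nat * R) :=
  [set t | [/\ (t.1 < n)%N, 0 <= t.2 < 1
             & (scale (1 - t.2) (P t.1) + scale t.2 (P t.1.+1)).1 = 0]].

(* The reflection points along the period are P 0, ..., P n.-1, so m0 = n. *)
Definition winding_numbers (n : nat) (P : nat -> R * R) (m0 m1 : nat) : Prop :=
  m0 = n /\ y_axis_passages n P #= `I_m1.

End Billiard.

(* Main.v *)
(* Write the successive vertices as (x_k, y_k) and let (f_k, g_k) be the directions
   of the chords, normalised so that the reflection law keeps their pairing with
   the normal of the ellipse equal to -1. Then
     u_{k+1} = u_k + l_k w_k,   w_{k+1} = w_k - s mu_{k+1} u_{k+1},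
   with l_k, mu_k > 0 not depending on s, has the solution (x, f) at s = 1/a and
   (y, g) at s = 1/b. It suffices to look at the trajectory that starts on the
   y-axis; there x is a multiple of the Dirichlet solution u (u_0 = 0, w_0 = 1) at
   s = 1/a, and m1 is its number of sign changes over a period.
   - Since u' w - u w' > 0, the polynomials u_k form a Sturm sequence: u_n has n - 1
     simple positive zeros, and m1 - 1 of them lie to the left of 1/a = c3.
   - The system has a Lax matrix, quadratic in s and with determinant
     -prod (s - c_i). By periodicity the monodromy matrix commutes with it, which
     makes u_n / (s - 1/a), up to a factor, the second component of a solution of
     Pell's equation of the same degree as q; hence u_n has the zeros of q and c3.
   - q divides p' with a cofactor of degree one, whose only zero lies in (c3, c2);
     by Rolle's theorem q then has no zeros in [c3, c2] and beyond c1.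
   Counting the zeros of u_n gives n - 1 = (m1 - 1) + 1 + tau1. *)

Require Import Defs.
From HB Require Import structures.
From mathcomp Require Import all_boot all_order all_algebra.
From mathcomp Require Import finmap polyorder polyrcf qe_rcf_th ring lra zify.
From mathcomp Require Import all_classical reals.

Set Implicit Arguments.
Unset Strict Implicit.
Unset Printing Implicit Defensive.

Import Order.TTheory GRing.Theory Num.Theory.

Local Open Scope card_scope.
Local Open Scope classical_set_scope.
Local Open Scope ring_scope.

(** * Roots and signs of two polynomials with positive Wronskian *)

Section Sturm.
Variable R : rcfType.
Implicit Types (f g h : {poly R}) (s t : R).

Lemma mu_simple_root h s : root h s -> h^`().[s] != 0 -> \mu_s h = 1%N.
Proof.
move=> hs h's; have h0 : h != 0 by apply: contraNneq h's => ->; rewrite deriv0 horner0.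
by rewrite (mu_deriv_root h0 hs) muNroot.
Qed.

Lemma jump_simple_root f g s : root f s -> f^`().[s] * g.[s] != 0 ->
  jump g f s = (-1) ^+ (f^`().[s] * g.[s] < 0)%R.
Proof.
move=> fs; rewrite mulf_eq0 => /norP[f's gs].
have ngs : ~~ root g s by rewrite rootE.
have g0 : g != 0 by apply: contraNneq gs => ->; rewrite horner0.
rewrite /jump g0 (mu_simple_root fs f's) (muNroot ngs) subn0 /= mulr1n.
rewrite sgp_right_mul (sgp_right_deriv fs) !sgp_rightNroot ?rootE //.
by rewrite -sgrM sgr_lt0 mulrC.
Qed.

(* With [f' g - f g' > 0], the index of [g / f] counts every root of [f] with
   sign [+1], and that of [f / g] every root of [g] with sign [-1]. *)
Lemma size_roots_wronskian f g (s t : R) : s < t ->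
    (forall z, s < z < t -> 0 < f^`().[z] * g.[z] - f.[z] * g^`().[z]) ->
    0 < f.[s] -> 0 < g.[s] -> f.[t] != 0 -> g.[t] != 0 ->
  size (roots g s t) = (size (roots f s t) + (f.[t] * g.[t] < 0)%R)%N.
Proof.
move=> st W fs gs ft gt.
have f0 : f != 0 by apply: contraNneq ft => ->; rewrite horner0.
have g0 : g != 0 by apply: contraNneq gt => ->; rewrite horner0.
have /(_ _ _)/[!rootE] := @cindex_inv R s t st f g.
rewrite !hornerM !mulf_eq0 !negb_or ft gt !gt_eqF// => /(_ isT isT).
have -> : cindex s t g f = (size (roots f s t))%:Z.
  rewrite /cindex big_seq (eq_bigr (fun=> 1)) => [|z].
    by rewrite -big_seq big_const_seq count_predT iter_addr addr0 natz.
  rewrite in_roots => /and3P[fz /[!in_itv] zst _].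
  have /[!(rootP fz)] := W _ zst.
  by rewrite mul0r subr0 => W0; rewrite jump_simple_root ?lt0r_neq0 // ltNge ltW.
have -> : cindex s t f g = - (size (roots g s t))%:Z.
  rewrite /cindex big_seq (eq_bigr (fun=> -1)) => [|z].
    by rewrite -big_seq big_const_seq count_predT iter_addr addr0 mulNrn natz.
  rewrite in_roots => /and3P[gz /[!in_itv] zst _].
  have /[!(rootP gz)] := W _ zst.
  rewrite mulr0 sub0r oppr_gt0 mulrC => W0.
  by rewrite jump_simple_root ?ltr0_neq0 // W0.
rewrite /cross /variation !hornerM pmulr_rlt0 ?mulr_gt0//.
case: ltrP => [fgt|_].
  by rewrite ltr0_sgz //; lia.
by rewrite mulr0; lia.
Qed.

(** At a root of [f] the derivative of [f g] equals the Wronskian, at a root of [g] its negative. So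
    just left of [t] a zero of [f] shows as a negative product and a zero of [g] as a positive one;
    this sign persists down to [s]. *)
Lemma lt0_prod_left f g (s t : R) : s < t ->
    0 < f^`().[t] * g.[t] - f.[t] * g^`().[t] ->
    (forall z, s <= z < t -> f.[z] * g.[z] != 0) ->
  (f.[s] * g.[s] < 0) = (f.[t] == 0) || (f.[t] * g.[t] < 0).
Proof.
move=> st W nr; rewrite -hornerM; set h := f * g.
have hnr z : s <= z < t -> ~~ root h z by move=> /nr; rewrite rootE hornerM.
have h0 : h != 0 by apply: contraNneq (hnr s _) => [->|]; rewrite ?root0 ?lexx.
have hs : h.[s] != 0 by rewrite -rootE hnr ?lexx.
have [ht|ht] := eqVneq h.[t] 0; last first.
  have := ht; rewrite hornerM mulf_eq0 => /norP[/negPf -> _] /=.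
  rewrite -hornerM -/h.
  apply/idP/idP => [sl|tl]; rewrite ltNge; apply/negP => ge0.
    have [|z] := @poly_ivtoo R h s t (ltW st).
      by rewrite nmulr_rlt0 // lt_neqAle eq_sym ht.
    by rewrite in_itv /= => /andP[z1 z2]; apply/negP/hnr; rewrite z2 ltW.
  have [|z] := @poly_ivtoo R h s t (ltW st).
    by rewrite nmulr_llt0 // lt_neqAle eq_sym hs.
  by rewrite in_itv /= => /andP[z1 z2]; apply/negP/hnr; rewrite z2 ltW.
have rht : root h t by rewrite rootE ht.
have key (e : h^`().[t] != 0) : (h.[s] < 0) = (0 < h^`().[t]).
  have sn : s \in neighpl h (s - 1) t.
    rewrite /neighpl in_itv /= st andbT.
    case: (prev_rootP h (s-1) t) => [/eqP|y _ hy yin _|c _ -> _].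
    - by rewrite (negPf h0).
    - rewrite ltNge; apply/negP => sy; move: yin; rewrite in_itv /= => /andP[_ yt].
      by have := hnr y; rewrite sy yt rootE hy eqxx => /(_ isT).
    - by rewrite gt_min ltrBlDr ltrDl ltr01.
  rewrite -sgr_lt0 (sgr_neighpl sn) (mu_simple_root rht e) expr1 mulN1r oppr_lt0.
  by rewrite (sgp_right_deriv rht) sgp_rightNroot ?rootE // sgr_gt0.
have dh : h^`().[t] = f^`().[t] * g.[t] + f.[t] * g^`().[t].
  by rewrite derivM hornerD !hornerM.
move: ht; rewrite hornerM => /eqP; rewrite mulf_eq0.
have [ft _|ft /= /eqP gt] := eqVneq f.[t] 0.
  move: W dh; rewrite ft mul0r subr0 addr0 => W dh.
  by rewrite key dh ?W // gt_eqF.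
move: W dh; rewrite gt !mulr0 !add0r oppr_gt0 ltxx => W dh.
by rewrite key dh ?lt_eqF // ltNge ltW.
Qed.

End Sturm.

(** * The Sturm sequence of the discrete linear system *)

Section Pencil.
Variables (R : rcfType) (l mu : nat -> R).
Hypothesis l_gt0 : forall k, 0 < l k.
Hypothesis mu_gt0 : forall k, 0 < mu k.

(** ['X] is the spectral parameter and [z] the initial pair: (0, 1) gives the Dirichlet solution,
    (1, 0) the other column of the transfer matrix. *)
Fixpoint pencil (z : {poly R} * {poly R}) (k : nat) : {poly R} * {poly R} :=
  if k is j.+1 then
    let u := (pencil z j).1 + l j *: (pencil z j).2 in
    (u, (pencil z j).2 - mu k *: ('X * u))
  else z.

Lemma pencil1S z k :
  (pencil z k.+1).1 = (pencil z k).1 + l k *: (pencil z k).2.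
Proof. by []. Qed.

Lemma pencil2S z k :
  (pencil z k.+1).2 = (pencil z k).2 - mu k.+1 *: ('X * (pencil z k.+1).1).
Proof. by []. Qed.

Local Notation u k := (pencil (0, 1) k).1.
Local Notation w k := (pencil (0, 1) k).2.

Lemma size_pencil k : [/\ (size (u k) <= k)%N, size (w k) = k.+1
  & 0 < (-1) ^+ k * lead_coef (w k)].
Proof.
elim: k => [|k [su sw lw]] /=.
  by rewrite size_poly0 size_poly1 lead_coef1 mul1r ltr01.
have slw : size (l k *: w k) = k.+1 by rewrite size_scale ?gt_eqF.
have suw : size (u k + l k *: w k) = k.+1.
  by rewrite addrC size_polyDl slw // ltnS.
have lu : lead_coef (u k + l k *: w k) = l k * lead_coef (w k).
  by rewrite addrC lead_coefDl ?slw ?ltnS // lead_coefZ.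
set v := u k + _ in suw lu *.
have v0 : v != 0 by rewrite -size_poly_eq0 suw.
have sv : size (- (mu k.+1 *: ('X * v))) = k.+2.
  by rewrite size_polyN size_scale ?gt_eqF // mulrC size_mulX // suw.
split; first by rewrite suw.
  by rewrite addrC size_polyDl sv // sw.
rewrite addrC lead_coefDl ?sv ?sw // lead_coefN lead_coefZ lead_coefM lead_coefX.
rewrite lu mul1r exprS mulN1r mulrNN mulrCA pmulr_rgt0 //.
by rewrite mulrCA pmulr_rgt0.
Qed.

Lemma size_pencilS k : size (u k.+1) = k.+1.
Proof.
have [su sw _] := size_pencil k.
have slw : size (l k *: w k) = k.+1 by rewrite size_scale ?gt_eqF.
by rewrite pencil1S addrC size_polyDl slw // ltnS.
Qed.

Lemma lead_coef_pencilS k : 0 < (-1) ^+ k * lead_coef (u k.+1).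
Proof.
have [su sw lw] := size_pencil k.
have slw : size (l k *: w k) = k.+1 by rewrite size_scale ?gt_eqF.
rewrite pencil1S addrC lead_coefDl ?slw ?ltnS // lead_coefZ mulrCA.
by rewrite pmulr_rgt0.
Qed.

Lemma pencil_at0 k : (w k).[0] = 1 /\ 0 < (u k.+1).[0].
Proof.
elim: k => [|k [w0 u0]].
  by rewrite /= add0r !hornerE.
have w1 : (w k.+1).[0] = 1.
  by rewrite pencil2S !(hornerD, hornerN, hornerZ, hornerM, hornerX) mul0r mulr0 subr0.
by rewrite w1 pencil1S hornerD hornerZ w1 mulr1 addr_gt0.
Qed.

Definition wronskian k (s : R) :=
  (u k)^`().[s] * (w k).[s] - (u k).[s] * (w k)^`().[s].

(** The chord step leaves [u' w - u w'] unchanged; the reflection step, the only one containing the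
    spectral parameter, adds [mu u^2]. *)
Lemma wronskianS k s :
  wronskian k.+1 s = wronskian k s + mu k.+1 * (u k.+1).[s] ^+ 2.
Proof.
rewrite /wronskian; move: (pencil1S (0, 1) k) (pencil2S (0, 1) k).
case: (pencil _ k.+1) (pencil _ k) => [u' w'] [u w] /= -> ->.
rewrite !(derivD, derivN, derivZ, derivM, derivX).
rewrite !(hornerD, hornerN, hornerZ, hornerM, hornerX) hornerC.
ring.
Qed.

Lemma wronskian_gt0 k s : 0 < wronskian k.+1 s.
Proof.
elim: k => [|k IH]; rewrite wronskianS.
  rewrite /wronskian /= deriv0 horner0 !mul0r subr0 !add0r hornerZ hornerC mulr1.
  by rewrite pmulr_rgt0 // exprn_gt0.
by rewrite ltr_wpDr // mulr_ge0 ?sqr_ge0 // ltW.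
Qed.

Lemma wronskian_succ_gt0 k s :
  0 < (u k.+1)^`().[s] * (u k.+2).[s] - (u k.+1).[s] * (u k.+2)^`().[s].
Proof.
rewrite (_ : _ - _ = l k.+1 * wronskian k.+1 s).
  by rewrite mulr_gt0 // wronskian_gt0.
rewrite /wronskian (pencil1S _ k.+1).
case: (pencil _ k.+1) => [u w] /=.
rewrite !(derivD, derivN, derivZ, derivM, derivX).
rewrite !(hornerD, hornerN, hornerZ, hornerM, hornerX); ring.
Qed.

(** All [u j.+1] are positive at 0 and the first is constant; each next one gains a root in [(0, s)]
    exactly when the two signs at [s] differ. *)
Lemma size_roots_pencil k s : 0 < s ->
    (forall j, (j <= k)%N -> (u j.+1).[s] != 0) ->
  size (roots (u k.+1) 0 s) =
    (\sum_(j < k) ((u j.+1).[s] * (u j.+2).[s] < 0)%R)%N.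
Proof.
move=> s0; elim: k => [|k IH] nr.
  by rewrite big_ord0 /= add0r -mul_polyC mulr1 rootsC.
rewrite big_ord_recr /= -IH => [|j jk]; last by rewrite nr // ltnW.
apply: size_roots_wronskian => //.
- by move=> z _; apply: wronskian_succ_gt0.
- by have [] := pencil_at0 k.
- by have [] := pencil_at0 k.+1.
- exact: (nr k).
- exact: (nr k.+1).
Qed.

Lemma pencil_neq0 k : u k.+1 != 0.
Proof. by rewrite -size_poly_eq0 size_pencilS. Qed.

(** Beyond all the Cauchy bounds every [u j.+1] has the sign of its leading coefficient, which
    alternates with [j]. *)
Lemma size_roots_pencil_max n (b : R) :
  exists2 s, b < s & size (roots (u n.+1) 0 s) = n.
Proof.
pose s := 1 + `|b| + \sum_(j < n.+1) cauchy_bound (u j.+1).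
have Sge0 : 0 <= \sum_(j < n.+1) cauchy_bound (u j.+1).
  by apply: sumr_ge0 => j _; apply: cauchy_bound_ge0.
have s0 : 0 < s by rewrite /s -addrA ltr_pwDl // addr_ge0.
have bs : b < s.
  rewrite /s (le_lt_trans (ler_norm b)) // addrAC ltr_pwDl // ltr_pwDl //.
have sj j : (j < n.+1)%N -> cauchy_bound (u j.+1) <= s.
  move=> jn; rewrite /s (bigD1 (Ordinal jn)) //= addrCA lerDl.
  by rewrite !addr_ge0 // sumr_ge0 // => i _; apply: cauchy_bound_ge0.
have sg j : (j < n.+1)%N -> Num.sg (u j.+1).[s] = (-1) ^+ j.
  move=> jn; rewrite (sgp_pinftyP (x := s)).
  - have := lead_coef_pencilS j; rewrite -sgr_gt0 sgrM sgrX sgrN1.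
    rewrite /sgp_pinfty; case: sgrP => [||_]; rewrite ?mulr0 ?ltxx ?mulr1 ?mulrN1.
    + by [].
    + by rewrite -signr_odd; case: (odd j); rewrite ?expr0 ?expr1 ?ltr0N1.
    + by rewrite -signr_odd; case: (odd j); rewrite ?expr0 ?expr1 ?oppr_gt0 ?ltr10.
  - move=> x; rewrite in_itv /= andbT => sx.
    apply: (ge_cauchy_bound (pencil_neq0 j)).
    by rewrite in_itv /= andbT (le_trans _ sx) // sj.
  - by rewrite in_itv /= lexx.
exists s => //; rewrite size_roots_pencil //.
  rewrite (eq_bigr (fun=> 1%N)) ?sum1_card ?card_ord // => j _.
  rewrite -sgr_lt0 sgrM !sg ?ltnS // 1?ltnW // exprS.
  by rewrite mulN1r mulrN -expr2 sqrr_sign ltrN10.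
by move=> j jn; rewrite -sgr_eq0 sg // signr_eq0.
Qed.

(** Here [c] may be a root of some [u j.+1], as happens when a vertex lies on the y-axis. The count
    is made just left of [c], and [lt0_prod_left] carries the signs over to [c]. *)
Lemma size_roots_pencil_left n (c : R) : 0 < c ->
  size (roots (u n.+1) 0 c) = (\sum_(j < n)
    (((u j.+1).[c] == 0) || ((u j.+1).[c] * (u j.+2).[c] < 0))%R)%N.
Proof.
move=> c0; pose U := \prod_(j < n.+1) u j.+1.
have U0 : U != 0 by apply/prodf_neq0 => j _; apply: pencil_neq0.
have := prev_root_lt c0 U0; set r := prev_root U 0 c => rc.
have r0 : 0 <= r.
  by have := prev_root_in U 0 c; rewrite in_itv /= min_l ?(ltW c0) // => /andP[].
(* [r] is the last root before [c] of the product of all [u j.+1], or 0 by default, so none of them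
   vanishes in [[s, c)]. *)
pose s := (r + c) / 2.
have sr : r < s < c by rewrite !midf_lt.
case/andP: sr => rs sc; have s0 : 0 < s by apply: le_lt_trans rs.
have nr j z : (j <= n)%N -> s <= z < c -> (u j.+1).[z] != 0.
  move=> jn /andP[sz zc]; rewrite -rootE.
  have : ~~ root U z.
    apply: (@prev_noroot _ U 0 c); rewrite in_itv /= zc andbT.
    exact: lt_le_trans sz.
  apply: contra; rewrite /U; have jn' : (j < n.+1)%N by [].
  by rewrite (bigD1 (Ordinal jn')) //= rootM => ->.
have -> : roots (u n.+1) 0 c = roots (u n.+1) 0 s.
  apply: (@lt_sorted_eq _ R); rewrite ?sorted_roots // => z.
  rewrite !in_roots !in_itv /=; case: rootP => //= uz; congr (_ && _).
  case: (ltP 0 z) => //= z0; apply/idP/idP => [zc|zs].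
    rewrite ltNge; apply/negP => sz; have := nr n z.
    by rewrite leqnn sz zc uz eqxx => /(_ isT isT).
  exact: lt_trans sc.
rewrite size_roots_pencil //; last by move=> j jn; rewrite nr // lexx.
apply: eq_bigr => j _; congr nat_of_bool.
apply: lt0_prod_left => // [|z zs]; first exact: wronskian_succ_gt0.
by rewrite mulf_neq0 ?nr // ltnW.
Qed.

End Pencil.

(** * Pell's equation with a quartic coefficient *)

Section Pell.
Variable R : rcfType.
Implicit Types (p q D : {poly R}).

Lemma pell_size D p q : size D = 5%N -> q != 0 -> p ^+ 2 - D * q ^+ 2 = 1 ->
  size p = (size q).+2.
Proof.
move=> sD q0 /eqP; rewrite subr_eq => /eqP pE.
have D0 : D != 0 by rewrite -size_poly_eq0 sD.
have sq : (0 < size q)%N by rewrite size_poly_gt0.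
have sDq : size (D * q ^+ 2) = (size q).*2.+3.
  rewrite size_mul ?expf_neq0 // sD expr2 size_mul //.
  by move: (size q) sq => m; lia.
have : size (p ^+ 2) = (size q).*2.+3.
  by rewrite pE addrC size_polyDl sDq // size_poly1.
have [->|p0] := eqVneq p 0; first by rewrite expr0n /= size_poly0.
rewrite expr2 size_mul //.
by have := p0; rewrite -size_poly_gt0; move: (size p) (size q) sq => m k; lia.
Qed.

(* [(q p1 - p q1) (q p1 + p q1) = q^2 - q1^2], where one of the two factors on
   the left has too large a degree unless the other one vanishes. *)
Lemma pell_unique D p q p1 q1 : size D = 5%N -> q != 0 -> size q1 = size q ->
    p ^+ 2 - D * q ^+ 2 = 1 -> p1 ^+ 2 - D * q1 ^+ 2 = 1 ->
  q1 ^+ 2 = q ^+ 2.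
Proof.
move=> sD q0 sq1 Hp Hp1.
have q10 : q1 != 0 by rewrite -size_poly_eq0 sq1 size_poly_eq0.
have sp := pell_size sD q0 Hp; have sp1 := pell_size sD q10 Hp1.
have p0 : p != 0 by rewrite -size_poly_eq0 sp.
have p10 : p1 != 0 by rewrite -size_poly_eq0 sp1.
have sq : (0 < size q)%N by rewrite size_poly_gt0.
have E : (q * p1 - p * q1) * (q * p1 + p * q1) = q ^+ 2 - q1 ^+ 2.
  have -> : (q * p1 - p * q1) * (q * p1 + p * q1) =
    q ^+ 2 * (p1 ^+ 2 - D * q1 ^+ 2) - q1 ^+ 2 * (p ^+ 2 - D * q ^+ 2) by ring.
  by rewrite Hp Hp1 !mulr1.
have ssub : (size (q ^+ 2 - q1 ^+ 2)%R <= (size q).*2.-1)%N.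
  rewrite (leq_trans (size_polyD _ _)) // geq_max size_polyN !expr2 !size_mul //.
  by rewrite sq1; move: (size q) sq => m; lia.
set A := _ - _ in E; set B := (_ + _) in E.
suff : A * B = 0 by rewrite E => /eqP; rewrite subr_eq0 => /eqP ->.
have [->|A0] := eqVneq A 0; first by rewrite mul0r.
have [->|B0] := eqVneq B 0; first by rewrite mulr0.
have sAB : (size A + size B <= (size q).*2)%N.
  move: ssub; rewrite -E size_mul //.
  have : (0 < size A)%N by rewrite size_poly_gt0.
  by move: (size A) (size B) (size q) sq => i j k; lia.
have : (size (A + B)%R <= maxn (size A) (size B))%N by apply: size_polyD.
have -> : A + B = 2 *: (q * p1) by rewrite /A /B scaler_nat; ring.
rewrite size_scale ?pnatr_eq0 // size_mul // sp1 sq1.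
have : (0 < size A)%N by rewrite size_poly_gt0.
have : (0 < size B)%N by rewrite size_poly_gt0.
by move: (size A) (size B) (size q) sAB sq => i j k; lia.
Qed.

Variables (D p q : {poly R}).
Hypothesis q_neq0 : q != 0.
Hypothesis sD : size D = 5%N.
Hypothesis pell : p ^+ 2 - D * q ^+ 2 = 1.

Let pE s : p.[s] ^+ 2 = 1 + D.[s] * q.[s] ^+ 2.
Proof.
move/(congr1 (horner^~ s)): pell.
rewrite !hornerE /= => <-; ring.
Qed.

(** Differentiation gives [2 p p' = q (D' q + 2 D q')], and Pell's equation itself is a Bezout
    relation between [q] and [p]. *)
Lemma pell_dvd_deriv : q %| p^`().
Proof.
have cqp : coprimep q p.
  apply/Bezout_coprimepP; exists (- (D * q), p) => /=.
  by rewrite (_ : _ + _ = 1) ?eqpxx // -[RHS]pell; ring.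
have : q %| p * (2 *: p^`()).
  have -> : p * (2 *: p^`()) = q * (D^`() * q + 2 * (D * q^`())).
    have /(congr1 deriv) : p ^+ 2 = 1 + D * q ^+ 2 by rewrite -pell; ring.
    rewrite !expr2 !derivE => e.
    transitivity (p^`() * p + p * p^`()); first by rewrite scaler_nat; ring.
    by rewrite e; ring.
  exact: dvdp_mulr.
by rewrite Gauss_dvdpr // dvdpZr // pnatr_eq0.
Qed.

Let L := p^`() %/ q.

Let LE : p^`() = L * q.
Proof. by rewrite divpK // pell_dvd_deriv. Qed.

Let size_L : size L = 2%N.
Proof.
have sp := pell_size sD q_neq0 pell.
rewrite size_divp // size_deriv sp /=.
have : (0 < size q)%N by rewrite size_poly_gt0.
by move: (size q) => m; lia.
Qed.

Let L_root_uniq s t : root L s -> root L t -> s = t.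
Proof.
move=> Ls Lt; apply/eqP; apply: contraT => st.
have L0 : L != 0 by rewrite -size_poly_eq0 size_L.
have := max_poly_roots L0 (rs := [:: s; t]).
by rewrite /= Ls Lt inE st size_L => /(_ isT isT).
Qed.

(** Dividing the differentiated equation by [q] gives [2 p L = D' q + 2 D q']; the right side
    vanishes at [s], whereas [p^2 = 1] there. *)
Let L_double_root s : root D s -> root q s -> root L s.
Proof.
move=> /rootP Ds /rootP qs.
have e : 2 *: (p * L) = D^`() * q + 2 *: (D * q^`()).
  apply: (mulIf q_neq0); rewrite !scaler_nat.
  have /(congr1 deriv) : p ^+ 2 = 1 + D * q ^+ 2 by rewrite -pell; ring.
  rewrite !expr2 !derivE LE => e.
  transitivity (L * q * p + p * (L * q)); first by ring.
  by rewrite e; ring.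
move/(congr1 (horner^~ s)): e.
rewrite !(hornerD, hornerM, hornerZ) Ds qs !(mulr0, mul0r) addr0 => /eqP.
rewrite !mulf_eq0 pnatr_eq0 /= rootE; case/orP => // /eqP p0; have := pE s.
by rewrite p0 Ds mul0r addr0 expr0n /= => /eqP; rewrite eq_sym oner_eq0.
Qed.

(** [p^2] is 1 at the roots of [D q] and at least 1 where [D > 0], so [p] keeps its sign and takes
    equal values at both ends. Rolle's theorem then gives a zero of [p' = L q]. *)
Let L_root_between (s t : R) : s < t -> (forall z, s < z < t -> 0 < D.[z]) ->
  root (D * q) s -> root (D * q) t -> exists2 z, s < z < t & root L z.
Proof.
move=> st Dpos Hs Ht.
have D0 : D != 0 by rewrite -size_poly_eq0 sD.
have H0 : D * q != 0 by rewrite mulf_neq0.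
(* [t'] is the first root of [D q] after [s], so that the zero from Rolle's theorem cannot be one of
   [q]. *)
have [t' [st' t't Ht' nr]] : exists t', [/\ s < t', t' <= t, root (D * q) t' &
    forall z, s < z < t' -> ~~ root (D * q) z].
  case: (next_rootP (D * q) s t) => [/eqP|y _ /rootP hy yin nr|c _ _ nr].
  - by rewrite (negPf H0).
  - move: yin; rewrite in_itv /= => /andP[sy yt].
    by exists y; split; rewrite ?(ltW yt) // => z zs; apply: nr; rewrite in_itv.
  - exists t; split => // z zs; apply: nr; rewrite in_itv; exact: zs.
have sq1 z : root (D * q) z -> p.[z] ^+ 2 = 1.
  by rewrite rootE hornerM => /eqP e; rewrite pE expr2 mulrA e mul0r addr0.
have pst : p.[s] = p.[t'].
  have /eqP := sq1 _ Hs; have /eqP := sq1 _ Ht'.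
  have nz z : s < z < t' -> p.[z] != 0.
    move=> /andP[sz zt]; apply/eqP => pz; have /esym/eqP := pE z.
    rewrite pz expr0n /= gt_eqF // ltr_pwDl // mulr_ge0 ?sqr_ge0 // ltW // Dpos //.
    by rewrite sz (lt_le_trans zt).
  have := @poly_ivtoo R p s t' (ltW st').
  rewrite !sqrf_eq1 => ivt /orP[] /eqP pt /orP[] /eqP ps; rewrite ps pt //.
  - have [|z] := ivt; first by rewrite ps pt mulr1 ltrN10.
    by rewrite in_itv => /nz pz /rootP pz0; rewrite pz0 eqxx in pz.
  - have [|z] := ivt; first by rewrite ps pt mul1r ltrN10.
    by rewrite in_itv => /nz pz /rootP pz0; rewrite pz0 eqxx in pz.
have [z] := poly_rolle st' pst.
rewrite in_itv /= => /andP[sz zt'] /eqP; rewrite LE hornerM mulf_eq0 => /orP[Lz|qz].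
  by exists z => //; rewrite sz (lt_le_trans zt').
have := nr z; rewrite sz zt' rootM => /(_ isT).
by rewrite negb_or [root q z]rootE qz andbF.
Qed.

(* The degree-one cofactor [L] of [q] in [p'] has a root in [(c3, c2)], and would
   have a second one if [q] had a root outside of the bands. *)
Lemma pell_roots_in_bands (c1 c2 c3 c4 : R) :
    D = ('X - c1%:P) * ('X - c2%:P) * ('X - c3%:P) * ('X - c4%:P) ->
    c4 < c3 -> c3 < c2 -> c2 < c1 ->
  forall s, root q s -> s < c3 \/ c2 < s < c1.
Proof.
move=> DE c43 c32 c21 s qs.
have DsE z : D.[z] = (z - c1) * (z - c2) * (z - c3) * (z - c4).
  by rewrite DE !hornerM !hornerXsubC.
have Dgap z : c3 < z < c2 -> 0 < D.[z].
  move=> /andP[z3 z2]; rewrite DsE.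
  have z1 := lt_trans z2 c21; have z4 := lt_trans c43 z3.
  rewrite mulr_gt0 ?subr_gt0 // mulr_gt0 ?subr_gt0 //.
  by rewrite nmulr_rgt0 subr_lt0.
have Dout z : c1 < z -> 0 < D.[z].
  move=> z1; rewrite DsE; have z2 := lt_trans c21 z1; have z3 := lt_trans c32 z2.
  by rewrite !mulr_gt0 ?subr_gt0 // (lt_trans c43).
have D1 : root D c1 by rewrite rootE DsE subrr !mul0r.
have D2 : root D c2 by rewrite rootE DsE subrr mulr0 !mul0r.
have D3 : root D c3 by rewrite rootE DsE subrr mulr0 !mul0r.
have [] := @L_root_between c3 c2; rewrite ?rootM ?D2 ?D3 //.
move=> g /andP[g3 g2] Lg.
have Lroot z : root L z -> z = g by move=> Lz; apply: L_root_uniq.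
(* A root of [q] at some [c_i] would be a common root with [D], hence a root of [L]; but [g] lies
   strictly between [c3] and [c2]. *)
have ns1 : s != c1.
  apply: contraTneq (lt_trans g2 c21) => sc; rewrite -(Lroot s) ?sc ?ltxx //.
  by apply: L_double_root; rewrite // -sc.
have ns2 : s != c2.
  apply: contraTneq g2 => sc; rewrite -(Lroot s) ?sc ?ltxx //.
  by apply: L_double_root; rewrite // -sc.
have ns3 : s != c3.
  apply: contraTneq g3 => sc; rewrite -(Lroot s) ?sc ?ltxx //.
  by apply: L_double_root; rewrite // -sc.
case: (ltgtP s c3) ns3 => [|s3 _|//]; first by left.
case: (ltgtP s c2) ns2 => [s2 _|s2 _|//].
  (* A root of [q] in the gap would split it into two intervals, each with a root of [L]. *)
  have [||||z /andP[_ zs] /Lroot zg] := @L_root_between c3 s;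
    rewrite ?rootM ?D3 ?qs ?orbT //.
    by move=> z /andP[z3 zs]; apply: Dgap; rewrite z3 (lt_trans zs).
  have [||||y /andP[sy _] /Lroot yg] := @L_root_between s c2;
    rewrite ?rootM ?D2 ?qs ?orbT //.
    by move=> y /andP[sy y2]; apply: Dgap; rewrite y2 (lt_trans s3).
  by move: (lt_trans zs sy); rewrite zg yg ltxx.
case: (ltgtP s c1) ns1 => [s1 _|s1 _|//]; first by right.
have [||||z /andP[zs _] /Lroot zg] := @L_root_between c1 s;
  rewrite ?rootM ?D1 ?qs ?orbT //.
  by move=> z /andP[z3 _]; apply: Dout.
by move: (lt_trans (lt_trans g2 c21) zs); rewrite zg ltxx.
Qed.

End Pell.

(** * Lax matrix and monodromy *)

Lemma poly_eq_gt (R : rcfType) (c : R) (p q : {poly R}) :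
  (forall s, c < s -> p.[s] = q.[s]) -> p = q.
Proof.
move=> e; apply/eqP; rewrite -subr_eq0; apply: contraT => pq0.
pose s := Num.max (c + 1) (cauchy_bound (p - q)).
have := @ge_cauchy_bound _ _ pq0 s.
rewrite in_itv /= /s le_max lexx orbT => /(_ isT).
by rewrite rootE hornerD hornerN e ?subrr ?eqxx // lt_max ltrDl ltr01.
Qed.

Section Lax.
Variable R : rcfType.
Variables (b1 b2 : R) (x y f g l mu : nat -> R).
Hypothesis xS : forall k, x k.+1 = x k + l k * f k.
Hypothesis yS : forall k, y k.+1 = y k + l k * g k.
Hypothesis fS : forall k, f k.+1 = f k - mu k.+1 * (b1 * x k.+1).
Hypothesis gS : forall k, g k.+1 = g k - mu k.+1 * (b2 * y k.+1).
Hypothesis xy_conic : forall k, b1 * x k ^+ 2 + b2 * y k ^+ 2 = 1.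
Hypothesis xy_out : forall k, b1 * x k * f k + b2 * y k * g k = -1.
Hypothesis mu_normal :
  forall k, mu k.+1 * ((b1 * x k.+1) ^+ 2 + (b2 * y k.+1) ^+ 2) = 2.

(** The Lax matrix with its poles at [b1] and [b2] cleared: [lax11] pairs position with direction,
    [lax12] position with itself, [lax21] direction with itself. *)
Let lax11 s k := - s * (b1 * x k * f k * (s - b2) + b2 * y k * g k * (s - b1)).
Let lax12 s k := - (s - b1) * (s - b2)
  + s * (b1 * x k ^+ 2 * (s - b2) + b2 * y k ^+ 2 * (s - b1)).
Let lax21 s k := - s * (b1 * f k ^+ 2 * (s - b2) + b2 * g k ^+ 2 * (s - b1)).

Let U z s k := (pencil l mu z k).1.[s].
Let W z s k := (pencil l mu z k).2.[s].

Let US z s k : U z s k.+1 = U z s k + l k * W z s k.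
Proof. by rewrite /U /W pencil1S hornerD hornerZ. Qed.

Let WS z s k : W z s k.+1 = W z s k - mu k.+1 * (s * U z s k.+1).
Proof.
by rewrite /U /W pencil2S hornerD hornerN hornerZ hornerM hornerX.
Qed.

Let xy_in k : b1 * x k.+1 * f k + b2 * y k.+1 * g k = 1.
Proof.
have := xy_out k.+1; rewrite fS gS => H1; have H2 := mu_normal k.
lra.
Qed.

(* The factors [(1 l; 0 1)] and [(1 0; -s mu 1)] of the transfer matrix conjugate
   the trace zero matrix [(lax11 lax12; lax21 -lax11)] at one vertex into the one
   at the next vertex. *)
Let laxS s k (v := s * mu k.+1) :
  [/\ lax11 s k.+1 = (lax11 s k + l k * lax21 s k) + v * lax12 s k.+1,
      lax12 s k.+1 = lax12 s k - 2 * l k * lax11 s k - l k ^+ 2 * lax21 s k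
    & lax21 s k.+1 = lax21 s k - 2 * v * (lax11 s k + l k * lax21 s k)
        - v ^+ 2 * lax12 s k.+1].
Proof.
have e1 := xy_conic k.+1; have e2 := xy_in k; have e3 := mu_normal k.
(* The diagonal entry between the two conjugations: the position is already that of vertex [k.+1],
   the direction still that of chord [k]. *)
have L11 : lax11 s k + l k * lax21 s k =
    - s * (b1 * x k.+1 * f k * (s - b2) + b2 * y k.+1 * g k * (s - b1)).
  by rewrite /lax11 /lax21 xS yS; ring.
rewrite L11; split.
- rewrite /lax11 /lax12 /v fS gS; apply/eqP; rewrite -subr_eq0; apply/eqP.
  transitivity (s * mu k.+1 * (s - b1) * (s - b2) *
    (1 - (b1 * x k.+1 ^+ 2 + b2 * y k.+1 ^+ 2))); first by ring.
  by rewrite e1 subrr mulr0.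
- by rewrite /lax11 /lax12 /lax21 xS yS; ring.
- rewrite /lax21 /lax12 /v fS gS; apply/eqP; rewrite -subr_eq0; apply/eqP.
  set X := x k.+1 in e1 e2 e3 *; set Y := y k.+1 in e1 e2 e3 *.
  set m := mu k.+1 in e3 *.
  transitivity (s * m * (s - b1) * (s - b2) *
    ((m * ((b1 * X) ^+ 2 + (b2 * Y) ^+ 2) - 2)
     - 2 * (b1 * X * f k + b2 * Y * g k - 1)
     + s * m * (b1 * X ^+ 2 + b2 * Y ^+ 2 - 1))); last first.
    by rewrite e1 e2 e3 !subrr !mulr0 subrr addr0 mulr0.
  ring.
Qed.

(** The transfer matrix from vertex 0 to vertex [k], with rows [A B] and [C E]. *)
Let A s k := U (1, 0) s k.
Let B s k := U (0, 1) s k.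
Let C s k := W (1, 0) s k.
Let E s k := W (0, 1) s k.

Let monodromy_det s k : A s k * E s k - B s k * C s k = 1.
Proof.
elim: k => [|k IH].
  by rewrite /A /B /C /E /U /W /= !hornerC mulr1 mul0r subr0.
rewrite -[RHS]IH /A /B /C /E !WS !US; ring.
Qed.

(** Entry by entry this is [L_k T_k = T_k L_0], with [L_k] the Lax matrix at vertex [k] and [T_k]
    the transfer matrix; it follows by iterating [laxS]. *)
Let lax_commute s k :
  [/\ lax11 s k * A s k + lax12 s k * C s k = A s k * lax11 s 0 + B s k * lax21 s 0,
      lax21 s k * A s k - lax11 s k * C s k = C s k * lax11 s 0 + E s k * lax21 s 0,
      lax11 s k * B s k + lax12 s k * E s k = A s k * lax12 s 0 - B s k * lax11 s 0
    & lax21 s k * B s k - lax11 s k * E s k = C s k * lax12 s 0 - E s k * lax11 s 0].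
Proof.
elim: k => [|k [e1 e2 e3 e4]].
  rewrite /A /B /C /E /U /W /= !hornerC.
  by rewrite !(mul0r, mulr0, mul1r, mulr1, add0r, addr0, sub0r, subr0).
have [-> E12 ->] := laxS s k.
rewrite /A /B /C /E !WS !US -/(A s k) -/(B s k) -/(C s k) -/(E s k) E12.
set v := mu k.+1; set p := l k.
split.
- transitivity ((lax11 s k * A s k + lax12 s k * C s k)
    + p * (lax21 s k * A s k - lax11 s k * C s k)); first by ring.
  by rewrite e1 e2; ring.
- transitivity ((lax21 s k * A s k - lax11 s k * C s k)
    - v * s * ((lax11 s k * A s k + lax12 s k * C s k)
    + p * (lax21 s k * A s k - lax11 s k * C s k))); first by ring.
  by rewrite e1 e2; ring.
- transitivity ((lax11 s k * B s k + lax12 s k * E s k)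
    + p * (lax21 s k * B s k - lax11 s k * E s k)); first by ring.
  by rewrite e3 e4; ring.
- transitivity ((lax21 s k * B s k - lax11 s k * E s k)
    - v * s * ((lax11 s k * B s k + lax12 s k * E s k)
    + p * (lax21 s k * B s k - lax11 s k * E s k))); first by ring.
  by rewrite e3 e4; ring.
Qed.

(** At [s = b1] the pencil recursion is that of [(x, f)], and [x 0 = 0] leaves only multiples of the
    Dirichlet solution. *)
Lemma pencil_x k : x 0 = 0 ->
  x k = f 0 * (pencil l mu (0, 1) k).1.[b1] /\
  f k = f 0 * (pencil l mu (0, 1) k).2.[b1].
Proof.
move=> x0; suff: x k = f 0 * B b1 k /\ f k = f 0 * E b1 k by [].
elim: k => [|k [xk fk]].
  by rewrite /B /E /U /W /= !hornerC mulr0 mulr1.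
have xk1 : x k.+1 = f 0 * B b1 k.+1.
  by rewrite xS xk fk /B US -/(B b1 k) -/(E b1 k); ring.
by split=> //; rewrite fS xk1 fk /E WS -/(B b1 k.+1) -/(E b1 k); ring.
Qed.

(* The monodromy over a period commutes with the Lax matrix, hence it is
   [alpha + h L] and its determinant is [alpha^2 + h^2 \det L]. *)
Lemma pencil_pell n : x 0 = 0 -> f 0 != 0 -> b2 != 0 ->
    x n = x 0 -> y n = y 0 -> f n = f 0 -> g n = g 0 ->
  exists alpha h : {poly R},
    (pencil l mu (0, 1) n).1 = b2 *: (('X - b1%:P) * h) /\
    alpha ^+ 2 - 'X * ('X - b1%:P) * ('X - b2%:P)
      * ('X - (b1 + b1 * b2 * f 0 ^+ 2)%:P) * h ^+ 2 = 1.
Proof.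
move=> x0 f0 b20 xn yn fn gn.
have Bb1 : root (pencil l mu (0, 1) n).1 b1.
  have [/esym/eqP] := pencil_x n x0.
  by rewrite xn x0 mulf_eq0 (negPf f0).
have [h0 Bh0] := factor_theorem _ _ Bb1.
(* On the axis [lax12] is [b2 (s - b1)], so this [h] is the coefficient of the Lax matrix in the
   monodromy; [alpha] is half the trace. *)
pose h := b2^-1 *: h0.
have Bh : (pencil l mu (0, 1) n).1 = b2 *: (('X - b1%:P) * h).
  by rewrite /h -scalerAr scalerA divff // scale1r mulrC.
pose alpha := 2^-1 *: ((pencil l mu (1, 0) n).1 + (pencil l mu (0, 1) n).2).
(* Comparing values at [s > b1] only allows [s - b1] to be cancelled. *)
exists alpha, h; split => //; apply: (@poly_eq_gt R b1) => s sb1.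
have Bs : B s n = b2 * ((s - b1) * h.[s]).
  by rewrite /B /U Bh hornerZ hornerM hornerXsubC.
have al : alpha.[s] = (A s n + E s n) / 2.
  by rewrite /alpha hornerZ hornerD mulrC.
rewrite !(hornerD, hornerN, hornerM, horner_exp, hornerX, hornerC) al.
have [e1 e2 e3 e4] := lax_commute s n.
have L11 : lax11 s n = lax11 s 0 by rewrite /lax11 xn yn fn gn.
have L12 : lax12 s n = lax12 s 0 by rewrite /lax12 xn yn.
have L21 : lax21 s n = lax21 s 0 by rewrite /lax21 fn gn.
rewrite {}L11 {}L12 {}L21 in e1 e2 e3 e4.
have := xy_conic 0; rewrite x0 expr0n mulr0 add0r => y0.
have := xy_out 0; rewrite x0 mulr0 mul0r add0r => yg0.
have g0 : b2 * g 0 ^+ 2 = 1.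
  transitivity (b2 * y 0 ^+ 2 * (b2 * g 0 ^+ 2)); first by rewrite y0 mul1r.
  transitivity ((b2 * y 0 * g 0) ^+ 2); first by ring.
  by rewrite yg0 sqrrN expr1n.
have l11 : lax11 s 0 = s * (s - b1).
  by rewrite /lax11 x0 yg0; ring.
have l12 : lax12 s 0 = b2 * (s - b1).
  by rewrite /lax12 x0 y0; ring.
have l21 : lax21 s 0 = - s * (b1 * f 0 ^+ 2 * (s - b2) + (s - b1)).
  by rewrite /lax21 g0 mul1r.
have sb0 : s - b1 != 0 by rewrite gt_eqF // subr_gt0.
(* The remaining entries of [T = alpha + h L] come from the second column of the commutation
   relation. *)
have AE : A s n - E s n = 2 * h.[s] * lax11 s 0.
  apply: (mulIf b20); apply: (mulIf sb0).
  rewrite l12 in e3.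
  transitivity (2 * B s n * lax11 s 0); last by rewrite Bs; ring.
  transitivity ((A s n * (b2 * (s - b1)) - B s n * lax11 s 0)
    - E s n * (b2 * (s - b1)) + B s n * lax11 s 0); first by ring.
  by rewrite -e3; ring.
have CE : C s n = h.[s] * lax21 s 0.
  apply: (mulIf b20); apply: (mulIf sb0).
  rewrite l12 in e4.
  transitivity (B s n * lax21 s 0); last by rewrite Bs; ring.
  transitivity ((C s n * (b2 * (s - b1)) - E s n * lax11 s 0)
    + E s n * lax11 s 0); first by ring.
  by rewrite -e4; ring.
rewrite -[RHS](monodromy_det s n) CE Bs.
transitivity (((A s n + E s n) / 2) ^+ 2 - ((A s n - E s n) / 2) ^+ 2
  - b2 * ((s - b1) * h.[s]) * (h.[s] * lax21 s 0)); last by field.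
by rewrite AE l11 l21; field.
Qed.

End Lax.

(** * The billiard map with normalised directions *)

Section Trajectory.
Variables (R : realType) (a b : R).
Hypotheses (a_gt0 : 0 < a) (b_gt0 : 0 < b).
Implicit Types (z : (R * R) * (R * R)) (P e : R * R).

(** For a normalised direction, the quadratic form of the ellipse at [P + t e] is
    [1 - 2 t + t^2 (e_1^2 / a + e_2^2 / b)]; this is the nonzero [t] where it is 1 again. *)
Definition chord e : R := 2 / (e.1 ^+ 2 / a + e.2 ^+ 2 / b).

(** Not the geometric curvature, but the multiple of the normal that reflection subtracts from a
    direction whose pairing with the normal is 1. *)
Definition curvature P : R :=
  2 / dot (ellipse_normal a b P) (ellipse_normal a b P).

(* The direction [e] of the chord leaving [P] is normalised by
   [dot (ellipse_normal a b P) e = -1], so that no square root is needed; the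
   reflection law preserves this normalisation. *)
Definition bounce z : (R * R) * (R * R) :=
  let P := z.1 + scale (chord z.2) z.2 in
  (P, z.2 - scale (curvature P) (ellipse_normal a b P)).

(** The squared length [K] of the direction is an invariant of the billiard map and encodes the
    caustic: [K = a b / l0] in [bounce_caustic]. *)
Definition admissible (K : R) z :=
  [/\ conic a b z.1, dot (ellipse_normal a b z.1) z.2 = -1 & dot z.2 z.2 = K].

Lemma weighted_sqr_gt0 (A B u v : R) :
  0 < A -> 0 < B -> (u, v) <> (0, 0) -> 0 < u ^+ 2 * A + v ^+ 2 * B.
Proof.
move=> A0 B0 uv; have [u0|u0] := eqVneq u 0; last first.
  apply: ltr_pwDl; first by rewrite mulr_gt0 // exprn_even_gt0.
  by rewrite mulr_ge0 ?sqr_ge0 // ltW.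
have v0 : v != 0 by apply/eqP => v0; apply: uv; rewrite u0 v0.
apply: ltr_wpDl; first by rewrite mulr_ge0 ?sqr_ge0 // ltW.
by rewrite mulr_gt0 // exprn_even_gt0.
Qed.

Lemma chord_denom_gt0 K z : admissible K z ->
  0 < z.2.1 ^+ 2 / a + z.2.2 ^+ 2 / b.
Proof.
case: z => [[x y] [f g]] [/= _ + _]; rewrite /dot /= => e.
apply: weighted_sqr_gt0; rewrite ?invr_gt0 // => -[f0 g0].
by move/eqP: e; rewrite f0 g0 !mulr0 addr0 eq_sym oppr_eq0 oner_eq0.
Qed.

Lemma curvature_denom_gt0 P : conic a b P ->
  0 < dot (ellipse_normal a b P) (ellipse_normal a b P).
Proof.
case: P => x y; rewrite /conic /dot /= => e; rewrite -!expr2.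
rewrite !expr_div_n; apply: weighted_sqr_gt0; rewrite ?invr_gt0 ?exprn_gt0 //.
case=> x0 y0; move/eqP: e.
by rewrite x0 y0 expr0n !mul0r addr0 eq_sym oner_eq0.
Qed.

Lemma chord_gt0 K z : admissible K z -> 0 < chord z.2.
Proof. by move=> /chord_denom_gt0 h; rewrite divr_gt0. Qed.

Lemma curvature_gt0 P : conic a b P -> 0 < curvature P.
Proof. by move=> /curvature_denom_gt0 h; rewrite divr_gt0. Qed.

Lemma bounce_admissible K z : admissible K z ->
  admissible K (bounce z) /\ dot (ellipse_normal a b (bounce z).1) z.2 = 1.
Proof.
move=> adm; have q0 := chord_denom_gt0 adm; case: (adm) => H1 H2 H3.
have lq : chord z.2 * (z.2.1 ^+ 2 / a + z.2.2 ^+ 2 / b) = 2.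
  by rewrite /chord divfK // gt_eqF.
have con : conic a b (bounce z).1.
  rewrite /bounce /=; move: H1 H2 lq; rewrite /conic /dot /=.
  case: (z) => [[x y] [f g]] /=; set l := chord _ => H1 H2 lq.
  transitivity ((x ^+ 2 / a + y ^+ 2 / b) + 2 * l * (x / a * f + y / b * g)
    + l * (l * (f ^+ 2 / a + g ^+ 2 / b))); first by ring.
  by rewrite H1 H2 lq; ring.
have inn : dot (ellipse_normal a b (bounce z).1) z.2 = 1.
  rewrite /bounce /=; move: H2 lq; rewrite /dot /=.
  case: (z) => [[x y] [f g]] /=; set l := chord _ => H2 lq.
  transitivity ((x / a * f + y / b * g)
    + (l * (f ^+ 2 / a + g ^+ 2 / b))); first by ring.
  by rewrite H2 lq; ring.
have nu0 := curvature_denom_gt0 con.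
have mn : curvature (bounce z).1 *
    dot (ellipse_normal a b (bounce z).1) (ellipse_normal a b (bounce z).1) = 2.
  by rewrite /curvature divfK // gt_eqF.
have e' : (bounce z).2 = z.2 - scale (curvature (bounce z).1)
    (ellipse_normal a b (bounce z).1) by [].
split=> //; split=> //; rewrite e' {e'};
  move: H3 inn mn; move: (curvature _) (ellipse_normal a b _) => m N;
  case: z.2 N => [f g] [X Y]; rewrite /dot /= => H3 inn mn.
  transitivity ((X * f + Y * g) - m * (X * X + Y * Y)); first by ring.
  by rewrite inn mn; ring.
transitivity ((f * f + g * g) - 2 * m * (X * f + Y * g)
  + m * (m * (X * X + Y * Y))); first by ring.
by rewrite H3 inn mn; ring.
Qed.

Variables (K : R) (z0 : (R * R) * (R * R)).
Hypothesis z0_adm : admissible K z0.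

Definition vertex k := (iter k bounce z0).1.
Definition direction k := (iter k bounce z0).2.

Lemma iter_admissible k : admissible K (iter k bounce z0).
Proof. by elim: k => //= k /bounce_admissible[]. Qed.

Lemma vertexS k :
  vertex k.+1 = vertex k + scale (chord (direction k)) (direction k).
Proof. by []. Qed.

Lemma directionS k : direction k.+1 =
  direction k - scale (curvature (vertex k.+1)) (ellipse_normal a b (vertex k.+1)).
Proof. by []. Qed.

Lemma bounce_trajectory : billiard_trajectory a b vertex.
Proof.
split=> [i|i|i].
- by have [] := iter_admissible i.
- have adm := iter_admissible i; rewrite vertexS.
  have l0 := chord_gt0 adm; case: adm => _; rewrite /dot -/(direction i) => H _ PP.
  rewrite -/(direction i) in l0.
  have [e1 e2] : scale (chord (direction i)) (direction i) = (0, 0).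
    by apply: (addrI (vertex i)); rewrite -PP; exact/esym/addr0.
  move/eqP: e1; rewrite mulf_eq0 gt_eqF //= => /eqP e1.
  move/eqP: e2; rewrite mulf_eq0 gt_eqF //= => /eqP e2.
  by move/eqP: H; rewrite e1 e2 !mulr0 addr0 eq_sym oppr_eq0 oner_eq0.
- have adm := iter_admissible i; have adm1 := iter_admissible i.+1.
  have l0 := chord_gt0 adm; have l1 := chord_gt0 adm1.
  have [_] := bounce_admissible adm; rewrite -/(iter i.+1 bounce z0).
  rewrite -/(vertex i.+1) -/(direction i) => inn.
  rewrite -/(direction _) in l0 l1.
  exists (chord (direction i.+1) / chord (direction i)); first by rewrite divr_gt0.
  rewrite (vertexS i.+1) addrC addKr.
  move: (chord (direction i.+1)) l1 => l1 l1p; rewrite directionS.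
  have -> : vertex i.+1 - vertex i = scale (chord (direction i)) (direction i).
    by rewrite vertexS addrC addKr.
  rewrite /curvature /mirror; move: (ellipse_normal a b _) inn => N.
  move: (chord (direction i)) l0 => l0 l0p.
  case: (direction i) N => [f g] [X Y]; rewrite /dot /scale /= => inn.
  have l0n : l0 != 0 by rewrite gt_eqF.
  have -> : 2 * (l0 * f * X + l0 * g * Y) = 2 * l0.
    by transitivity (2 * l0 * (X * f + Y * g)); [ring|rewrite inn mulr1].
  congr (_, _) => /=.
    transitivity (l1 / l0 * l0 * (f - 2 / (X * X + Y * Y) * X)); last by ring.
    by rewrite divfK.
  transitivity (l1 / l0 * l0 * (g - 2 / (X * X + Y * Y) * Y)); last by ring.
  by rewrite divfK.
Qed.

(* The pole of the line through [P] with direction [e] with respect to the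
   confocal conic. *)
Lemma bounce_caustic (l0 : R) : 0 < l0 -> a - l0 != 0 -> b - l0 != 0 ->
  K = a * b / l0 -> has_caustic a b l0 vertex.
Proof.
move=> l0p al bl KE i; have [] := iter_admissible i.
rewrite vertexS -/(vertex i) -/(direction i).
move: (chord _) => l; case: (vertex i) (direction i) => [x y] [f g].
rewrite /conic /dot /tangent_line /= => H1 H2 H3.
exists ((a - l0) * g), (- (b - l0) * f), (x * g - y * f); split.
- case=> /eqP + /eqP + _; rewrite mulNr oppr_eq0 !mulf_eq0 (negPf al) (negPf bl) /=.
  move=> /eqP g0 /eqP f0; move/eqP: H2.
  by rewrite f0 g0 !mulr0 addr0 eq_sym oppr_eq0 oner_eq0.
- transitivity ((a - l0) * g ^+ 2 + (b - l0) * f ^+ 2); first by field; rewrite al bl.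
  have an : a != 0 by rewrite gt_eqF.
  have bn : b != 0 by rewrite gt_eqF.
  have ln : l0 != 0 by rewrite gt_eqF.
  transitivity (a * b * ((f ^+ 2 / a + g ^+ 2 / b)) - l0 * (f * f + g * g)).
    by field; rewrite an bn.
  rewrite H3 KE.
  (* Lagrange's identity: the bracket equals [(x g - y f)^2 / (a b)]. *)
  transitivity (a * b * ((x ^+ 2 / a + y ^+ 2 / b) * (f ^+ 2 / a + g ^+ 2 / b)
    - (x / a * f + y / b * g) ^+ 2)); last by field; rewrite an bn.
  by rewrite H1 H2; field; rewrite an bn ln.
- by field; rewrite al bl.
- by field; rewrite al bl.
Qed.

(** Equal vertices at [n], [n.+1] and at 0, 1 make the two directions proportional; pairing both
    with the same normal, which gives -1 each time, fixes the factor. *)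
Lemma direction_periodic n : n_periodic n vertex -> direction n = direction 0.
Proof.
move=> [_ per]; have Pn := per 0; have Pn1 := per 1%N; rewrite add0n in Pn.
rewrite add1n !vertexS Pn in Pn1; move/addrI: Pn1 => e.
have [_ Hn _] := iter_admissible n; have [_ H0 _] := iter_admissible 0.
have l0 := chord_gt0 (iter_admissible 0).
rewrite -/(vertex n) Pn -/(direction n) in Hn.
rewrite -/(vertex 0) -/(direction 0) in H0 l0.
move: (chord (direction n)) (chord (direction 0)) e l0 => ln l0.
move: (ellipse_normal a b _) (direction n) (direction 0) Hn H0.
move=> [X Y] [f g] [f0 g0]; rewrite /dot /scale /= => Hn H0 [e1 e2] l0p.
have : - ln = - l0.
  transitivity (X * (ln * f) + Y * (ln * g)).
    by transitivity (ln * (X * f + Y * g)); [rewrite Hn mulrN1|ring].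
  rewrite e1 e2; transitivity (l0 * (X * f0 + Y * g0)); first by ring.
  by rewrite H0 mulrN1.
move/oppr_inj => ll; rewrite ll in e1 e2.
have l0n : l0 != 0 by rewrite gt_eqF.
by rewrite (mulfI l0n e1) (mulfI l0n e2).
Qed.

End Trajectory.

(** * Counting the passages through the y-axis *)

Lemma card_eq_uniq_seq (T : choiceType) (s : seq T) :
  uniq s -> [set x | x \in s] #= `I_(size s).
Proof.
move=> us; have -> : [set x | x \in s] = [set` [fset x in s]%fset].
  by apply/seteqP; split=> x /=; rewrite inE.
by apply/card_eq_fsetP; rewrite card_fseq undup_id.
Qed.

(** The hypothesis excludes segments along the axis, so each segment meets it at most once and a
    passage is determined by its index. With parameters in [[0, 1)] it is met exactly when the
    segment starts there or its ends lie strictly on opposite sides. *)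
Lemma card_y_axis_passages (R : realType) (n : nat) (P : nat -> R * R) :
    (forall i, (P i).1 = 0 -> (P i.+1).1 <> 0) ->
  y_axis_passages n P #= `I_(\sum_(i < n)
    (((P i).1 == 0) || ((P i).1 * (P i.+1).1 < 0))%R)%N.
Proof.
move=> nz; pose c i := ((P i).1 == 0) || ((P i).1 * (P i.+1).1 < 0).
have -> : (\sum_(i < n) (c i : nat) = size [seq i <- iota 0 n | c i])%N.
  rewrite size_filter -sum1_count [RHS]big_mkcond /=.
  rewrite -[in RHS](subn0 n) -/(index_iota 0 n) big_mkord.
  by apply: eq_bigr => i _; case: (c i).
apply: (card_eq_trans _ (card_eq_uniq_seq (filter_uniq c (iota_uniq 0 n)))).
rewrite card_eq_sym.
have -> : [set i | i \in [seq i <- iota 0 n | c i]] = fst @` y_axis_passages n P.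
  apply/seteqP; split=> [i /=|_ [[i t] /= [] /= il t01 e] <-].
    rewrite mem_filter mem_iota add0n => /andP[ci /= il].
    suff [t t01 e] : exists2 t : R, 0 <= t < 1 &
        (1 - t) * (P i).1 + t * (P i.+1).1 = 0 by exists (i, t).
    case/orP: ci => [/eqP x0|xx].
      by exists 0; rewrite ?lexx ?ltr01 // x0 mulr0 mul0r addr0.
    move: ((P i).1) ((P i.+1).1) xx => x x' xx.
    have d : 0 < (x - x') ^+ 2.
      rewrite exprn_even_gt0 // subr_eq0.
      by apply: contraTneq xx => ->; rewrite -expr2 -leNgt sqr_ge0.
    have dn : x - x' != 0 by rewrite -sqrf_eq0 gt_eqF.
    have x2 := sqr_ge0 x; have x'2 := sqr_ge0 x'.
    exists (x / (x - x')); last by field.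
    have -> : x / (x - x') = (x * (x - x')) / (x - x') ^+ 2 by field.
    rewrite divr_ge0 ?ltW //=; last by nra.
    by rewrite ltr_pdivrMr // mul1r; nra.
  rewrite mem_filter mem_iota add0n /= il andbT /c.
  have [//|x0 /=] := eqVneq (P i).1 0.
  move: e t01; move: ((P i).1) ((P i.+1).1) x0 => x x' x0 e /andP[t0 t1].
  have x2 : 0 < x ^+ 2 by rewrite exprn_even_gt0.
  have e2 : t * (x * x') = - ((1 - t) * x ^+ 2).
    have : x * ((1 - t) * x + t * x') = 0 by rewrite e mulr0.
    by move=> h; apply/eqP; rewrite -subr_eq0; apply/eqP; rewrite -[RHS]h; ring.
  have tp : 0 < t.
    rewrite lt_neqAle t0 andbT; apply/eqP => t_0; move/eqP: e.
    by rewrite -t_0 subr0 mul1r mul0r addr0 (negPf x0).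
  by rewrite -(pmulr_rlt0 _ tp) e2 oppr_lt0 mulr_gt0 // subr_gt0.
apply: inj_card_eq => -[i t] [j t'] /set_mem[/= _ _ e] /set_mem[/= _ _ e'] ij.
rewrite -ij in e' *; congr (_, _).
have e3 : (t - t') * ((P i.+1).1 - (P i).1) = 0.
  transitivity (((1 - t) * (P i).1 + t * (P i.+1).1)
    - ((1 - t') * (P i).1 + t' * (P i.+1).1)); first by ring.
  by rewrite e e' subrr.
move/eqP: e3; rewrite mulf_eq0 !subr_eq0 => /orP[/eqP //|/eqP xx].
have x0 : (P i).1 = 0 by rewrite -e xx; ring.
by case: (nz _ x0); rewrite xx.
Qed.

(** * The trajectory from the y-axis as a solution of the pencil *)

Section TrajectoryPencil.
Variables (R : realType) (a b K : R) (z0 : (R * R) * (R * R)).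
Hypotheses (a_gt0 : 0 < a) (b_gt0 : 0 < b).
Hypothesis z0_adm : admissible a b K z0.
Hypothesis z0_axis : z0.1.1 = 0.

Let P := vertex a b z0.
Let e := direction a b z0.
Let l k := chord a b (e k).
Let mu k := curvature a b (P k).

Let adm k : admissible a b K (iter k (bounce a b) z0).
Proof. exact: iter_admissible. Qed.

Let xS k : (P k.+1).1 = (P k).1 + l k * (e k).1. Proof. by []. Qed.
Let yS k : (P k.+1).2 = (P k).2 + l k * (e k).2. Proof. by []. Qed.
Let fS k : (e k.+1).1 = (e k).1 - mu k.+1 * (a^-1 * (P k.+1).1).
Proof. by rewrite [a^-1 * _]mulrC. Qed.
Let gS k : (e k.+1).2 = (e k).2 - mu k.+1 * (b^-1 * (P k.+1).2).
Proof. by rewrite [b^-1 * _]mulrC. Qed.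

Let xy_conic k : a^-1 * (P k).1 ^+ 2 + b^-1 * (P k).2 ^+ 2 = 1.
Proof. by have [<- _ _] := adm k; rewrite ![_^-1 * _]mulrC. Qed.

Let xy_out k : a^-1 * (P k).1 * (e k).1 + b^-1 * (P k).2 * (e k).2 = -1.
Proof. by have [_ <- _] := adm k; rewrite ![_^-1 * _]mulrC. Qed.

Let mu_normal k :
  mu k.+1 * ((a^-1 * (P k.+1).1) ^+ 2 + (b^-1 * (P k.+1).2) ^+ 2) = 2.
Proof.
have [c _ _] := adm k.+1.
rewrite ![_^-1 * _]mulrC !expr2 /mu /curvature divfK // gt_eqF //.
exact: curvature_denom_gt0.
Qed.

Lemma vertex_pencil k :
  (P k).1 = (e 0).1 * (pencil l mu (0, 1) k).1.[a^-1].
Proof. by have [] := pencil_x xS fS k z0_axis. Qed.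

Lemma pencil_pell_periodic n : n_periodic n P -> (e 0).1 != 0 ->
  exists alpha h : {poly R},
    (pencil l mu (0, 1) n).1 = b^-1 *: (('X - (a^-1)%:P) * h) /\
    alpha ^+ 2 - 'X * ('X - (a^-1)%:P) * ('X - (b^-1)%:P)
      * ('X - (a^-1 + a^-1 * b^-1 * (e 0).1 ^+ 2)%:P) * h ^+ 2 = 1.
Proof.
move=> per f0; have en := direction_periodic a_gt0 b_gt0 z0_adm per.
have Pn : P n = P 0 by case: per => _ /(_ 0).
apply: (pencil_pell xS yS fS gS xy_conic xy_out mu_normal) => //.
- by rewrite invr_eq0 gt_eqF.
- by rewrite Pn.
- by rewrite Pn.
- by rewrite /e en.
- by rewrite /e en.
Qed.

Lemma chord_direction_gt0 k : 0 < l k.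
Proof. exact: chord_gt0 (adm k). Qed.

Lemma curvature_vertex_gt0 k : 0 < mu k.
Proof. by have [c _ _] := adm k; apply: curvature_gt0. Qed.

End TrajectoryPencil.

(** * Locating and counting the zeros of [u n] *)

Theorem mainTheorem11 (R : realType) (a b l0 : R)
  (hb : 0 < b) (hab : b < a)
  (hl0 : 0 < l0 < b \/ b < l0 < a)
  (n m0 m1 : nat) (hm0 : m0 = n)
  (htraj : forall P : nat -> R * R,
     billiard_trajectory a b P -> has_caustic a b l0 P ->
     n_periodic n P /\ winding_numbers n P m0 m1)
  (c1 c2 c3 c4 : R)
  (hc : [/\ c1 > c2, c2 > c3, c3 > c4 & c4 = 0])
  (hcset : [:: c1; c2; c3; c4] =i [:: 0; 1 / a; 1 / b; 1 / l0])
  (p q : {poly R})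
  (hp : size p = n.+1) (hq : (size q).+1 = n)
  (hpell : p ^+ 2 -
     (\prod_(c <- [:: c1; c2; c3; c4]) ('X - c%:P)) * q ^+ 2 = 1)
  (tau1 : nat)
  (htau1 : [set s : R | c2 < s < c1 /\ root q s] #= `I_tau1) :
  m0 = (m1 + tau1 + 1)%N /\ (m1 < m0)%N.
Proof.
have a0 : 0 < a by apply: lt_trans hab.
have [l00 l0a l0b] : [/\ 0 < l0, l0 < a & l0 != b].
  case: hl0 => /andP[h1 h2]; split=> //.
  - exact: lt_trans hab.
  - by rewrite lt_eqF.
  - exact: lt_trans h1.
  - by rewrite gt_eqF.
have [an bn ln] : [/\ a != 0, b != 0 & l0 != 0] by rewrite !gt_eqF.
(* At the vertex [(0, y0)] the normalisation forces the second component [- y0]; the squared length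
   [a b / l0] required by the caustic then determines [f0]. *)
pose f0 := Num.sqrt (b * (a - l0) / l0); pose y0 := Num.sqrt b.
have f00 : 0 < f0 by rewrite sqrtr_gt0 divr_gt0 // mulr_gt0 // subr_gt0.
have f02 : f0 ^+ 2 = b * (a - l0) / l0.
  by rewrite sqr_sqrtr // divr_ge0 ?ltW // mulr_gt0 // subr_gt0.
have y02 : y0 ^+ 2 = b by rewrite sqr_sqrtr // ltW.
pose z0 : (R * R) * (R * R) := ((0, y0), (f0, - y0)).
have adm : admissible a b (a * b / l0) z0.
  split; rewrite /conic /dot /=.
  - by rewrite y02 expr0n mul0r add0r divff.
  - transitivity (- (y0 ^+ 2 / b)); first by ring.
    by rewrite y02 divff.
  - transitivity (f0 ^+ 2 + y0 ^+ 2); first by ring.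
    by rewrite f02 y02; field.
pose P := vertex a b z0.
have [per [_ pas]] : n_periodic n P /\ winding_numbers n P m0 m1.
  apply: htraj; first exact: bounce_trajectory adm.
  apply: bounce_caustic adm _ l00 _ _ _ => //.
    by rewrite subr_eq0 gt_eqF.
  by rewrite subr_eq0 eq_sym.
pose l k := chord a b (direction a b z0 k); pose mu k := curvature a b (P k).
have l_gt0 k : 0 < l k by apply: chord_direction_gt0 adm _.
have mu_gt0 k : 0 < mu k by apply: curvature_vertex_gt0 adm _.
pose u k := (pencil l mu (0, 1) k).1.
have Pu k : (P k).1 = f0 * (u k).[a^-1] by apply: (@vertex_pencil R a b z0).
have [alpha [h [uh hpell']]] :=
  pencil_pell_periodic a0 hb adm (erefl _) per (lt0r_neq0 f00).
rewrite -/(l _) -/(mu _) in uh.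
(* The choice of [f0] makes [1/l0] the fourth zero of the Lax determinant. *)
have lE : a^-1 + a^-1 * b^-1 * f0 ^+ 2 = l0^-1.
  by rewrite f02; field; rewrite ln bn an.
rewrite [(direction _ _ _ _).1]/= lE in hpell'.
case: hc => c21 c32 c43 c40.
have ab1 : a^-1 < b^-1 by rewrite ltf_pV2.
have al1 : a^-1 < l0^-1 by rewrite ltf_pV2.
have ai0 : 0 < a^-1 by rewrite invr_gt0.
have perm : perm_eq [:: c1; c2; c3; c4] [:: 0; a^-1; b^-1; l0^-1].
  apply: uniq_perm; last by move=> z; rewrite hcset !div1r.
    have c31 := lt_trans c32 c21; have c42 := lt_trans c43 c32.
    by rewrite /= !inE !negb_or !gt_eqF // (lt_trans c43).
  rewrite /= !inE !negb_or !(eq_sym 0) (eq_sym a^-1 b^-1) (eq_sym a^-1 l0^-1).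
  rewrite !invr_eq0 an bn ln (gt_eqF ab1) (gt_eqF al1) /= ?andbT.
  by apply: contra l0b => /eqP/invr_inj ->.
(* As [b < a] and [l0 < a], the least nonzero element of the set is [1/a]. *)
have c3E : c3 = a^-1.
  have c3le z : z \in [:: a^-1; b^-1; l0^-1] -> a^-1 <= z.
    by rewrite !inE => /or3P[] /eqP ->; rewrite ?lexx ?ltW.
  have mc z : z \in [:: c1; c2; c3; c4] -> z != 0 -> a^-1 <= z.
    by rewrite (perm_mem perm) inE => /orP[/eqP ->|/c3le //]; rewrite eqxx.
  have le3 : a^-1 <= c3 by rewrite mc ?inE ?eqxx ?orbT // -c40 gt_eqF.
  have : a^-1 \in [:: c1; c2; c3; c4] by rewrite (perm_mem perm) !inE eqxx orbT.
  rewrite !inE => /or4P[] /eqP e.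
  - by move: le3; rewrite e leNgt (lt_trans c32).
  - by move: le3; rewrite e leNgt c32.
  - by [].
  - by move: ai0; rewrite e c40 ltxx.
pose D : {poly R} := ('X - c1%:P) * ('X - c2%:P) * ('X - c3%:P) * ('X - c4%:P).
have DE : \prod_(c <- [:: c1; c2; c3; c4]) ('X - c%:P) = D.
  by rewrite !big_cons big_nil mulr1 /D !mulrA.
have DE' : 'X * ('X - (a^-1)%:P) * ('X - (b^-1)%:P) * ('X - (l0^-1)%:P) = D.
  by rewrite -DE (perm_big _ perm) /= !big_cons big_nil mulr1 subr0 !mulrA.
rewrite DE in hpell; rewrite DE' in hpell'.
have sD : size D = 5%N.
  by rewrite -DE size_prod_XsubC.
have q0 : q != 0.
  apply/eqP => q0; move: hpell hp; rewrite -hq q0 expr0n mulr0 subr0 size_poly0.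
  move=> /eqP; rewrite sqrf_eq1 => /orP[] /eqP ->;
    by rewrite ?size_polyN size_poly1.
have [m nE] : exists m, n = m.+2.
  exists (size q).-1; rewrite -hq prednK // size_poly_gt0 //.
have sq : size q = m.+1 by move: hq; rewrite nE => -[].
have su : size (u n) = m.+2 by rewrite nE; apply: size_pencilS.
have h0 : h != 0.
  by apply: contra_eq_neq su => h0; rewrite /u uh h0 mulr0 scaler0 size_poly0.
have sh : size h = size q.
  move: su; rewrite /u uh size_scale ?invr_eq0 // size_mul ?polyXsubC_eq0 //.
  by rewrite size_XsubC /= sq => -[].
(* Pell solutions of equal degree have the same [q] up to sign, so [h] and [q] share their roots. *)
have hq2 := pell_unique sD q0 sh hpell hpell'.
have ru z : root (u n) z = (z == a^-1) || root q z.
  rewrite /u uh rootZ ?invr_eq0 // rootM root_XsubC; congr (_ || _).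
  by rewrite !rootE -[LHS]sqrf_eq0 -[RHS]sqrf_eq0 -!horner_exp hq2.
have u0 : u n != 0 by rewrite -size_poly_eq0 su.
have bands := pell_roots_in_bands q0 sD hpell (erefl D) c43 c32 c21.
have nqa : ~~ root q a^-1.
  by apply/negP => /bands[]; rewrite -c3E ?ltxx // ltNge (ltW c32).
have szt : size (roots q c2 c1) = tau1.
  apply/card_eq_II; rewrite -(card_eqr htau1) card_eq_sym.
  have := card_eq_uniq_seq (uniq_roots c2 c1 q).
  have -> // : [set x | x \in roots q c2 c1] = [set s | c2 < s < c1 /\ root q s].
  apply/seteqP; split=> z /=; rewrite in_roots in_itv q0 andbT.
    by move=> /andP[].
  by case=> -> ->.
(* To the left of [S > c1] lie all [n - 1] zeros of [u n]; they are [c3] and the roots of [q], which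
   lie below [c3] or in [(c2, c1)]. *)
have [S c1S sS] := size_roots_pencil_max l_gt0 mu_gt0 m.+1 c1.
rewrite -/(u m.+2) -nE in sS.
have c2_gt0 : 0 < c2 by rewrite -c40 (lt_trans c43).
have c3_gt0 : 0 < c3 by rewrite -c40.
have split_roots : size (roots (u n) 0 S) =
    (size (roots q 0 c3) + tau1).+1.
  have pe : perm_eq (roots (u n) 0 S) (c3 :: roots q 0 c3 ++ roots q c2 c1).
    apply: uniq_perm; first exact: uniq_roots.
      rewrite /= mem_cat !in_roots c3E (negPf nqa) /= cat_uniq !uniq_roots andbT /=.
      apply/hasPn => z; rewrite !in_roots !in_itv /= => /and3P[_ /andP[z2 _] _].
      rewrite -c3E; apply/negP => /and3P[_ /andP[_ z3] _].
      by have := lt_trans (lt_trans z3 c32) z2; rewrite ltxx.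
    move=> z; rewrite inE mem_cat !in_roots !in_itv /= u0 q0 !andbT ru -c3E.
    have [->|zc] /= := eqVneq z c3.
      by rewrite c3_gt0 (lt_trans c32) // (lt_trans c21).
    have [qz|//] := boolP (root q z); rewrite /=.
    case: (bands z qz) => [z3|/andP[z2 z1]].
      rewrite z3 andbT (lt_trans z3) ?andbT; last first.
        by rewrite (lt_trans c32) // (lt_trans c21).
      by rewrite [c2 < z]ltNge (ltW (lt_trans z3 c32)) orbF.
    by rewrite z2 z1 orbT (lt_trans c2_gt0 z2) (lt_trans z1).
  by rewrite (perm_size pe) /= size_cat szt.
have left_roots : size (roots (u n) 0 c3) = size (roots q 0 c3).
  apply: perm_size; apply: uniq_perm; rewrite ?uniq_roots // => z.
  rewrite !in_roots !in_itv /= u0 q0 !andbT ru -c3E.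
  by have [->|//] := eqVneq z c3; rewrite ltxx !andbF.
have m1E : m1 = (size (roots (u n) 0 c3)).+1.
  apply/card_eq_II; rewrite -(card_eql pas).
  have nz i : (P i).1 = 0 -> (P i.+1).1 <> 0.
    rewrite !Pu => /eqP; rewrite mulf_eq0 (gt_eqF f00) /= => /eqP ui.
    move/eqP; rewrite mulf_eq0 (gt_eqF f00) /= => /eqP ui1.
    (* [u 1] is a positive constant; later neighbours have no common zero because of their
       Wronskian. *)
    case: i ui ui1 => [|k] ui ui1.
      move/eqP: ui1; rewrite /u /= add0r hornerZ hornerC mulr1.
      by rewrite gt_eqF.
    have := wronskian_succ_gt0 l_gt0 mu_gt0 k a^-1.
    by rewrite -!/(u _) ui ui1 mulr0 mul0r subrr ltxx.
  suff <- : (\sum_(i < n) (((P i).1 == 0) || ((P i).1 * (P i.+1).1 < 0))%R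
      = (size (roots (u n) 0 c3)).+1)%N by apply: card_y_axis_passages.
  (* Segment 0 counts because it starts on the axis, whence the successor; the other segments give
     the sign changes of [u 1], ..., [u n] at [c3]. *)
  rewrite nE big_ord_recl (eqxx 0 : (P (ord0 : 'I_m.+2)).1 == 0) orTb add1n.
  congr _.+1.
  rewrite /u (size_roots_pencil_left l_gt0 mu_gt0 m.+1 c3_gt0).
  apply: eq_bigr => i _; rewrite lift0 !Pu c3E.
  rewrite mulf_eq0 (gt_eqF f00) /=; congr (nat_of_bool (_ || _)).
  by rewrite mulrACA pmulr_rlt0 // mulr_gt0.
rewrite hm0 m1E left_roots addn1.
by move: sS; rewrite split_roots nE => <-; rewrite -addSn leq_addr.
Qed.
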